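(* Suppose that $(\mathbf{X},\mathbf{Y})$ is good and that $\mathbf{H}(\mathbf{Y})=0$. Let $\mathbf{M}=\mathbf{X}\cdot\mathbf{Y}=(X_iY_i)_{i\in\mathbb{Z}}$. Then $$\mathbb{P}(Y_0=1)\,\mathbf{H}(\mathbf{X})\le\mathbf{H}(\mathbf{M})\le\mathbb{P}(Y_0=1)\,\mathbf{H}(X_0).$$ In particular, $\mathbf{H}(\mathbf{M})>0$ whenever $\mathbf{H}(\mathbf{X})>0$.
   Context: All processes are bilateral (indexed by $\mathbb{Z}$), real-valued and defined on a probability space $(\Omega,\mathcal{F},\mathbb{P})$. The pair $(\mathbf{X},\mathbf{Y})$, $\mathbf{X}=(X_i)_{i\in\mathbb{Z}}$, $\mathbf{Y}=(Y_i)_{i\in\mathbb{Z}}$, is called good if: $\mathbf{X}$ and $\mathbf{Y}$ are stationary; $\mathbf{X}$ takes values in a finite set; $Y_i\in\{0,1\}$ and $\mathbb{P}(Y_0=1)>0$; $\mathbf{X}$ and $\mathbf{Y}$ are independent; and almost surely $Y_i=1$ for infinitely many $i\ge 0$ and for infinitely many $i\le 0$ (so that the successive times at which $\mathbf{Y}$ visits $1$ are well defined in both directions). $\mathbf{H}(X_0)$ is the Shannon entropy (base-2 logarithm) of the random variable $X_0$; for a stationary finitely-valued process $\mathbf{Z}$, $\mathbf{H}(\mathbf{Z})=\lim_n\frac1n\mathbf{H}(Z_0,\ldots,Z_{n-1})$ is its entropy rate. *)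

(* Defs.v *)
From HB Require Import structures.
From mathcomp Require Import all_boot all_order all_algebra.
From mathcomp Require Import all_classical all_reals all_analysis.

Set Implicit Arguments.
Unset Strict Implicit.
Unset Printing Implicit Defensive.

Import Order.TTheory GRing.Theory Num.Theory numFieldNormedType.Exports.

Local Open Scope classical_set_scope.
Local Open Scope ring_scope.

(* The product sigma-algebra on R^Z. *)
Definition path_measurable (R : realType) : set (set (int -> R)) :=
  <<s [set A | exists (i : int) (B : set R),
         measurable B /\ A = [set x | B (x i)]] >>.

Section processes.
Context d (T : measurableType d) (R : realType) (P : probability T R).

Implicit Types (X Y : int -> {RV P >-> R}) (Z : int -> T -> R).

Definition stationary X : Prop :=
  forall (k : int) (A : set (int -> R)), path_measurable A ->
    P [set w | A (fun i => X (i + k) w)] = P [set w | A (fun i => X i w)].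

Definition independent_processes X Y : Prop :=
  forall A B : set (int -> R), path_measurable A -> path_measurable B ->
    P ([set w | A (fun i => X i w)] `&` [set w | B (fun i => Y i w)]) =
    (P [set w | A (fun i => X i w)] * P [set w | B (fun i => Y i w)])%E.

Record good X Y : Prop := Good {
  good_stationaryX : stationary X ;
  good_stationaryY : stationary Y ;
  good_finiteX : exists A : set R, finite_set A /\ forall i w, A (X i w) ;
  good_binaryY : forall i w, Y i w = 0 \/ Y i w = 1 ;
  good_visitY : (0 < P [set w | Y 0%R w = 1%R])%E ;
  good_independent : independent_processes X Y ;
  good_recurrent : {ae P, forall w,
    infinite_set [set i : int | 0 <= i /\ Y i w = 1] /\
    infinite_set [set i : int | i <= 0 /\ Y i w = 1]} }.

(* Meaningful when V has a finite range; since ln 0 = 0, values of probability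
   zero contribute nothing, as in the usual convention 0 log 0 = 0. *)
Definition entropy (E : choiceType) (V : T -> E) : R :=
  \sum_(v \in range V)
    let p := fine (P [set w | V w = v]) in - (p * (ln p / ln 2)).

Definition block Z (n : nat) (w : T) : n.-tuple R :=
  [tuple Z (i : nat)%:Z w | i < n].

(* The term of index 0 is 0 / 0 = 0 and does not affect the limit. *)
Definition entropy_rate Z : R :=
  limn (fun n : nat => entropy (block Z n) / n%:R : R).

End processes.

(* Main.v *)
Require Import Defs.
From HB Require Import structures.
From mathcomp Require Import all_boot all_order all_algebra.
From mathcomp Require Import all_classical all_reals all_analysis.
From mathcomp Require Import finmap lra.

Set Implicit Arguments.
Unset Strict Implicit.
Unset Printing Implicit Defensive.

Import Order.TTheory GRing.Theory Num.Theory numFieldNormedType.Exports.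

Local Open Scope classical_set_scope.
Local Open Scope ring_scope.

(** Write a^X_n for the entropy of n consecutive values of X, likewise a^Y_n
and a^M_n, and p for the probability that Y_0 = 1.  Both inequalities are
limits, after division by n, of
<<
   p a^X_n  <=  a^M_n  <=  a^Y_n + n p H(X_0),
>>
where a^Y_n / n vanishes in the limit because Y has entropy rate zero.

Given the whole block y of Y, and since X is independent of Y, the block of M
is the block of X in which the coordinates with y_i = 0 are erased.  The chain
rule for a product measure ([fin_entropy_prod]) therefore says that the joint
entropy of the blocks of Y and M is a^Y_n plus the mean over y of the entropy
of the erased block.
- Upper bound: a^M_n is at most this joint entropy, and the entropy of the
  erased block is at most the sum of H(X_i) over the coordinates kept
  ([fin_entropy_masked_le]); on average there are n p of them.
- Lower bound: the joint entropy is at most a^Y_n + a^M_n, so a^M_n is at least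
  the mean entropy of the erased block.  A coordinate that is kept contributes
  its entropy given the kept coordinates before it, which is at least its
  entropy given all coordinates before it, namely a^X_(i+1) - a^X_i
  ([fin_entropy_masked_ge]).  Coordinate i is kept with probability p for every
  i, so the mean of these contributions telescopes to p a^X_n.

The rates are defined by limits, which have to exist.  For a stationary process
submodularity of entropy makes n |-> a_n concave, so that a_n / n is
nonincreasing ([concave_mean_cvg], [entropy_rate_cvg]).  M is stationary because
X and Y are stationary and independent.

All inequalities between entropies come from submodularity
([fin_entropy_submodular]) on a finite probability space, the space of coded
blocks; [entropy_comp] carries them to the given probability space. *)

(** * Entropy on a finite space *)

Section finite_entropy.
Variables (R : realType) (O : finType) (mu : O -> R).

Definition class_mass (E : eqType) (f : O -> E) (w : O) : R :=
  \sum_(v | f v == f w) mu v.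

(** This is the expectation of - ln (mu (f = f w)), the Shannon entropy of f in
nats.  Summing over points instead of over values makes it visible that only
the partition into fibers of f matters, and allows f to take its values in an
infinite type. *)
Definition fin_entropy (E : eqType) (f : O -> E) : R :=
  - \sum_w mu w * ln (class_mass f w).

Lemma eq_fin_entropy (E F : eqType) (f : O -> E) (g : O -> F) :
  (forall v w, (f v == f w) = (g v == g w)) -> fin_entropy f = fin_entropy g.
Proof.
move=> fg; congr (- _); apply: eq_bigr => w _; congr (_ * ln _).
exact: eq_bigl.
Qed.

Hypothesis mu_ge0 : forall w, 0 <= mu w.

Lemma class_mass_gt0 (E : eqType) (f : O -> E) w :
  0 < mu w -> 0 < class_mass f w.
Proof.
move=> w0; apply: (lt_le_trans w0); rewrite /class_mass (bigD1 w) //=.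
by rewrite lerDl sumr_ge0.
Qed.

Lemma class_mass_ge0 (E : eqType) (f : O -> E) w : 0 <= class_mass f w.
Proof. exact: sumr_ge0. Qed.

(** All points of Q lie in one fiber of h, so the denominators agree and bound
the sum of the numerators.  Division by zero is harmless: it yields 0. *)
Lemma sum_class_le1 (E : eqType) (h : O -> E) (Q : pred O) :
  (forall v w, Q v -> Q w -> h v = h w) ->
  \sum_(w | Q w) mu w / class_mass h w <= 1.
Proof.
move=> Qh; case: (pickP Q) => [u Qu|Q0]; last by rewrite big_pred0.
under eq_bigr => w Qw.
  rewrite (_ : class_mass h w = class_mass h u); last first.
    by rewrite /class_mass (Qh _ _ Qw Qu).
  over.
rewrite -mulr_suml.
have [m0|m0] := ltP 0 (class_mass h u).
  rewrite ler_pdivrMr // mul1r /class_mass big_mkcond [leRHS]big_mkcond /=.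
  apply: ler_sum => w _; case: ifP => Qw; last by case: ifP.
  by rewrite (Qh _ _ Qw Qu) eqxx.
have -> : class_mass h u = 0 by apply/le_anti; rewrite m0 class_mass_ge0.
by rewrite invr0 mulr0.
Qed.

(** This is the nonnegativity of the conditional mutual information of f and g
given c.  By ln t <= t - 1 it reduces to bounding by the total mass the sum of
<<
   mu w * mass (f, c) * mass (g, c) / (mass (f, g, c) * mass c).
>>
Expanding both masses of pairs into sums over points u and v, the points w
compatible with given u and v lie in one fiber of (f, g, c), and what remains is
a sum over the pairs u, v with c u = c v. *)
Lemma fin_entropy_submodular (E F G : eqType)
    (f : O -> E) (g : O -> F) (c : O -> G) :
  fin_entropy (fun w => (f w, g w, c w)) + fin_entropy c <=
  fin_entropy (fun w => (f w, c w)) + fin_entropy (fun w => (g w, c w)).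
Proof.
set fgc := fun w => (f w, g w, c w).
set fc := fun w => (f w, c w); set gc := fun w => (g w, c w).
pose K w := class_mass gc w / (class_mass fgc w * class_mass c w).
suff le_mass : \sum_w mu w * (class_mass fc w * K w) <= \sum_w mu w.
  (* ln t <= t - 1 at t = mass fc * K, pointwise where mu is positive *)
  have : \sum_w mu w * (ln (class_mass fc w) + ln (class_mass gc w) -
      (ln (class_mass fgc w) + ln (class_mass c w))) <= 0.
    apply: (@le_trans _ _ (\sum_w (mu w * (class_mass fc w * K w) - mu w))).
      apply: ler_sum => w _; rewrite -[X in _ <= _ - X]mulr1 -[leRHS]mulrBr.
      have := mu_ge0 w; rewrite le_eqVlt => /predU1P[<-|w0].
        by rewrite !mul0r.
      have fc0 := class_mass_gt0 fc w0; have gc0 := class_mass_gt0 gc w0.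
      have h0 := class_mass_gt0 fgc w0; have c0 := class_mass_gt0 c w0.
      rewrite ler_pM2l // -!lnM ?posrE // -ln_div ?posrE ?mulr_gt0 //.
      rewrite -mulrA -/(K w); set t := class_mass fc w * K w.
      have t0 : 0 < t by rewrite !mulr_gt0 ?invr_gt0 ?mulr_gt0.
      rewrite -[X in ln X](subrK 1) addrC le_ln1Dx //.
      by rewrite ltrBrDl subrr.
    by rewrite sumrB subr_le0.
  under eq_bigr => w _ do rewrite mulrBr !mulrDr.
  by rewrite sumrB !big_split /= subr_le0 -!opprD lerN2.
(* expand the mass of fc over u, then fix u *)
under eq_bigr => w _ do rewrite /class_mass mulr_suml mulr_sumr.
rewrite (exchange_big_dep xpredT) //=.
under eq_bigr => u _ do under eq_bigr => w _ do rewrite mulrCA.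
under eq_bigr => u _ do rewrite -mulr_sumr.
apply: ler_sum => u _; rewrite -[leRHS]mulr1 ler_wpM2l //.
have fc_c w : fc u == fc w -> class_mass c w = class_mass c u.
  by move=> /eqP[_ cw]; rewrite /class_mass cw.
under eq_bigr => w fcw do rewrite /K fc_c // invfM !mulrA.
rewrite -mulr_suml.
suff le_c : \sum_(w | fc u == fc w) mu w * class_mass gc w / class_mass fgc w
    <= class_mass c u.
  have := class_mass_ge0 c u; rewrite le_eqVlt => /predU1P[<-|c0].
    by rewrite invr0 mulr0.
  by rewrite ler_pdivrMr // mul1r.
(* expand the mass of gc over v, which must satisfy c v = c u *)
under eq_bigr => w _ do rewrite mulrAC mulrC mulr_suml.
rewrite (exchange_big_dep (fun v => c v == c u)) /=; last first.
  by move=> w v /eqP[_ ->] /eqP[_ ->].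
rewrite /class_mass; apply: ler_sum => v _.
rewrite -mulr_sumr -[leRHS]mulr1 ler_wpM2l //.
apply: (@sum_class_le1 _ fgc) => w w'.
move=> /andP[/eqP[fw cw] /eqP[gw _]] /andP[/eqP[fw' cw'] /eqP[gw' _]].
by rewrite /fgc -fw -fw' -gw -gw' -cw -cw'.
Qed.

Lemma fin_entropy_mono (E F : eqType) (f : O -> E) (g : O -> F) :
  (forall v w, g v == g w -> f v == f w) -> fin_entropy f <= fin_entropy g.
Proof.
move=> gf; rewrite lerN2; apply: ler_sum => w _.
have := mu_ge0 w; rewrite le_eqVlt => /predU1P[<-|w0]; first by rewrite !mul0r.
rewrite ler_pM2l // ler_ln ?posrE ?class_mass_gt0 //.
rewrite /class_mass big_mkcond [leRHS]big_mkcond; apply: ler_sum => v _.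
by case: ifP => [/gf ->//|_]; case: ifP.
Qed.

Hypothesis mu_sum1 : \sum_w mu w = 1.

Lemma fin_entropy_const (E : eqType) (e : E) : fin_entropy (fun=> e) = 0.
Proof.
rewrite /fin_entropy big1 ?oppr0 // => w _.
rewrite /class_mass (eq_bigl xpredT) ?mu_sum1 ?ln1 ?mulr0 // => v.
exact: eqxx.
Qed.

Lemma fin_entropy_ge0 (E : eqType) (f : O -> E) : 0 <= fin_entropy f.
Proof. by rewrite -(fin_entropy_const tt) fin_entropy_mono. Qed.

(** Submodularity for a constant c. *)
Lemma fin_entropy_subadditive (E F : eqType) (f : O -> E) (g : O -> F) :
  fin_entropy (fun w => (f w, g w)) <= fin_entropy f + fin_entropy g.
Proof.
have := fin_entropy_submodular f g (fun=> tt).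
rewrite fin_entropy_const addr0.
rewrite (@eq_fin_entropy _ _ _ (fun w => (f w, g w))); last first.
  by move=> v w; rewrite !xpair_eqE ?eqxx ?andbT.
rewrite (@eq_fin_entropy _ _ (fun w => (f w, tt)) f); last first.
  by move=> v w; rewrite xpair_eqE ?eqxx ?andbT.
rewrite (@eq_fin_entropy _ _ (fun w => (g w, tt)) g) //.
by move=> v w; rewrite xpair_eqE ?eqxx ?andbT.
Qed.

(** * Sequences of variables and erased coordinates *)

Definition prefix_of (E : eqType) (z : nat -> O -> E) k (w : O) : seq E :=
  mkseq (z^~ w) k.

Lemma prefix_ofS (E : eqType) (z : nat -> O -> E) k v w :
  (prefix_of z k.+1 v == prefix_of z k.+1 w) =
  (prefix_of z k v == prefix_of z k w) && (z k v == z k w).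
Proof. by rewrite /prefix_of !mkseqS eqseq_rcons. Qed.

Lemma prefix_ofSl (E : eqType) (z : nat -> O -> E) k v w :
  (prefix_of z k.+1 v == prefix_of z k.+1 w) =
  (z 0%N v == z 0%N w) &&
  (prefix_of (fun i => z i.+1) k v == prefix_of (fun i => z i.+1) k w).
Proof.
by rewrite /prefix_of /mkseq /= eqseq_cons -[1%N]addn0 !iotaDl -!map_comp.
Qed.

Lemma fin_entropy_prefixS (E : eqType) (z : nat -> O -> E) k :
  fin_entropy (prefix_of z k.+1) <=
  fin_entropy (prefix_of z k) + fin_entropy (z k).
Proof.
apply: le_trans (fin_entropy_subadditive _ _).
by apply: fin_entropy_mono => v w; rewrite prefix_ofS xpair_eqE.
Qed.

Lemma fin_entropy_prefix_le (E : eqType) (z : nat -> O -> E) k :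
  fin_entropy (prefix_of z k) <= \sum_(i < k) fin_entropy (z i).
Proof.
elim: k => [|k IH]; first by rewrite big_ord0 (fin_entropy_const [::]).
by rewrite big_ord_recr /= (le_trans (fin_entropy_prefixS z k)) // lerD2r.
Qed.

Lemma prefix_of_mask (z : nat -> O -> R) (y : nat -> R) k v w :
  prefix_of z k v == prefix_of z k w ->
  prefix_of (fun i u => z i u * y i) k v ==
  prefix_of (fun i u => z i u * y i) k w.
Proof.
move=> /eqP e; apply/eqP.
apply/eq_in_map => i; rewrite mem_iota /= add0n => ik.
have := congr1 (fun s => nth 0 s i) e.
by rewrite !nth_mkseq // => ->.
Qed.

(** Induction on k.  When coordinate k is kept, submodularity for z k and the
full prefix, given the masked prefix, says that conditioning on the full prefix
lowers the entropy of z k at least as much as conditioning on the masked one. *)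
Lemma fin_entropy_masked_ge (z : nat -> O -> R) (y : nat -> R) k :
  (forall i, (i < k)%N -> y i = 0 \/ y i = 1) ->
  \sum_(i < k) y i *
     (fin_entropy (prefix_of z i.+1) - fin_entropy (prefix_of z i)) <=
  fin_entropy (prefix_of (fun i w => z i w * y i) k).
Proof.
set zy := fun i w => z i w * y i.
elim: k => [|k IH] y01; first by rewrite big_ord0 (fin_entropy_const [::]).
rewrite big_ord_recr /=.
have {}IH := IH (fun i ik => y01 i (leqW ik)).
case: (y01 k (leqnn _)) => yk.
  rewrite yk mul0r addr0; apply: (le_trans IH).
  by apply: fin_entropy_mono => v w; rewrite prefix_ofS => /andP[].
rewrite yk mul1r; apply: (le_trans (lerD IH (lexx _))).
rewrite addrA lerBlDr.
have := fin_entropy_submodular (z k) (prefix_of z k) (prefix_of zy k).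
rewrite (@eq_fin_entropy _ _ _ (prefix_of z k.+1)); last first.
  move=> v w; rewrite !xpair_eqE prefix_ofS [RHS]andbC.
  by rewrite andb_idr // => /andP[_]; exact: prefix_of_mask.
rewrite addrC => /le_trans; apply; rewrite lerD //.
  apply: fin_entropy_mono => v w; rewrite prefix_ofS xpair_eqE /zy yk !mulr1.
  by rewrite andbC.
apply: fin_entropy_mono => v w e.
by rewrite xpair_eqE e (prefix_of_mask _ e).
Qed.

Lemma fin_entropy_masked_le (z : nat -> O -> R) (y : nat -> R) k :
  (forall i, (i < k)%N -> y i = 0 \/ y i = 1) ->
  fin_entropy (prefix_of (fun i w => z i w * y i) k) <=
  \sum_(i < k) y i * fin_entropy (z i).
Proof.
move=> y01; apply: (le_trans (fin_entropy_prefix_le _ _)).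
apply: ler_sum => i _; case: (y01 i (ltn_ord i)) => ->.
  rewrite mul0r (@eq_fin_entropy _ _ _ (fun=> 0 : R)) ?fin_entropy_const //.
  by move=> v w; rewrite !mulr0.
by rewrite mul1r fin_entropy_mono // => v w; rewrite !mulr1.
Qed.

End finite_entropy.

(** * Independent pairs *)

Section product.
Variables (R : realType) (O1 O2 : finType) (mu : O1 -> R) (nu : O2 -> R).
Hypotheses (mu_ge0 : forall x, 0 <= mu x) (nu_ge0 : forall y, 0 <= nu y).
Hypotheses (mu_sum1 : \sum_x mu x = 1) (nu_sum1 : \sum_y nu y = 1).

Definition prod_mass (w : O1 * O2) : R := mu w.1 * nu w.2.

Lemma prod_mass_ge0 w : 0 <= prod_mass w.
Proof. exact: mulr_ge0. Qed.

Lemma prod_mass_sum1 : \sum_w prod_mass w = 1.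
Proof.
rewrite -(pair_bigA _ (fun x y => mu x * nu y)) /=.
by under eq_bigr => x _ do rewrite -mulr_sumr nu_sum1 mulr1.
Qed.

(** Chain rule: since the coordinates are independent, conditioning on the
second one leaves the law of the first one unchanged, and the conditional
entropy is the mean of the entropies of the sections g y. *)
Lemma fin_entropy_prod (E : eqType) (g : O2 -> O1 -> E) :
  fin_entropy prod_mass (fun w => (w.2, g w.2 w.1)) =
  fin_entropy nu id + \sum_y nu y * fin_entropy mu (g y).
Proof.
have mass x y : class_mass prod_mass (fun w => (w.2, g w.2 w.1)) (x, y) =
    nu y * class_mass mu (g y) x.
  rewrite /class_mass mulr_sumr.
  rewrite -(pair_big_dep xpredT (fun x' y' => (y', g y' x') == (y, g y x))
    (fun x' y' => mu x' * nu y')) /= [RHS]big_mkcond; apply: eq_bigr => x' _.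
  rewrite big_mkcond (bigD1 y) //= big1 ?addr0; last first.
    by move=> y' /negPf yy'; rewrite xpair_eqE yy'.
  by rewrite xpair_eqE eqxx mulrC.
rewrite /fin_entropy (eq_bigr (fun w : O1 * O2 => mu w.1 * nu w.2 *
   ln (nu w.2 * class_mass mu (g w.2) w.1))); last by case=> x y _; rewrite mass.
rewrite -(pair_bigA _ (fun x y => mu x * nu y *
   ln (nu y * class_mass mu (g y) x))) /= exchange_big /=.
rewrite -sumrN -[X in X + _]sumrN -big_split /=; apply: eq_bigr => y _.
have -> : class_mass nu id y = nu y by rewrite /class_mass big_pred1_eq.
rewrite mulrN -opprD; congr (- _).
rewrite -[X in X * ln _]mul1r -mu_sum1 -mulrA mulr_suml mulr_sumr -big_split /=.
apply: eq_bigr => x _.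
have := mu_ge0 x; rewrite le_eqVlt => /predU1P[<-|x0];
  first by rewrite !(mul0r,mulr0,addr0).
have := nu_ge0 y; rewrite le_eqVlt => /predU1P[<-|y0];
  first by rewrite !(mul0r,mulr0,addr0).
rewrite lnM ?posrE ?class_mass_gt0 // mulrDr mulrA; congr (_ + _).
by rewrite mulrA [nu y * _]mulrC.
Qed.

Lemma fin_entropy_snd : fin_entropy prod_mass snd = fin_entropy nu id.
Proof.
have := fin_entropy_prod (fun _ _ => tt).
rewrite [X in _ + X]big1 ?addr0; last first.
  by move=> y _; rewrite fin_entropy_const // mulr0.
move<-; apply: eq_fin_entropy => v w; by rewrite xpair_eqE ?eqxx ?andbT.
Qed.

End product.

(** * A product with an independent mask *)

Section masking.
Variables (R : realType) (O1 O2 : finType) (mu : O1 -> R) (nu : O2 -> R).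
Hypotheses (mu_ge0 : forall x, 0 <= mu x) (nu_ge0 : forall y, 0 <= nu y).
Hypotheses (mu_sum1 : \sum_x mu x = 1) (nu_sum1 : \sum_y nu y = 1).
Variables (x : nat -> O1 -> R) (y : nat -> O2 -> R) (n : nat) (p : R).
Hypothesis y01 : forall i w, (i < n)%N -> y i w = 0 \/ y i w = 1.
Hypothesis y_mean : forall i, (i < n)%N -> \sum_w nu w * y i w = p.

Let masked i (w : O1 * O2) := x i w.1 * y i w.2.

Lemma sum_mean (F : nat -> R) :
  \sum_w nu w * (\sum_(i < n) y i w * F i) = p * \sum_(i < n) F i.
Proof.
under eq_bigr => w _ do rewrite mulr_sumr.
rewrite exchange_big mulr_sumr /=; apply: eq_bigr => i _.
by rewrite -(y_mean (ltn_ord i)) mulr_suml; apply: eq_bigr => w _; rewrite mulrA.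
Qed.

Lemma fin_entropy_masked_and_mask :
  fin_entropy (prod_mass mu nu) (fun w => (w.2, prefix_of masked n w)) =
  fin_entropy nu id + \sum_w nu w *
    fin_entropy mu (prefix_of (fun i v => x i v * y i w) n).
Proof. by rewrite -fin_entropy_prod. Qed.

(** Subadditivity removes the entropy of the mask from the joint entropy; the
increments of [fin_entropy_masked_ge] then telescope, as each has the same mean
weight p. *)
Lemma fin_entropy_prod_masked_ge :
  p * fin_entropy mu (prefix_of x n) <=
  fin_entropy (prod_mass mu nu) (prefix_of masked n).
Proof.
have mn_ge0 := prod_mass_ge0 mu_ge0 nu_ge0.
have mn1 := prod_mass_sum1 mu_sum1 nu_sum1.
rewrite -(lerD2l (fin_entropy nu id)).
rewrite -[in leRHS](fin_entropy_snd mu_ge0 nu_ge0 mu_sum1).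
apply: le_trans (fin_entropy_subadditive mn_ge0 mn1 _ _).
rewrite fin_entropy_masked_and_mask lerD2l.
pose h k := fin_entropy mu (prefix_of x k).
have -> : fin_entropy mu (prefix_of x n) = \sum_(i < n) (h i.+1 - h i).
  rewrite -(big_mkord xpredT (fun k => h k.+1 - h k)) telescope_sumr //.
  by rewrite /h (fin_entropy_const mu_sum1 [::]) subr0.
rewrite -(sum_mean (fun i => h i.+1 - h i)); apply: ler_sum => w _.
rewrite ler_wpM2l //.
by apply: fin_entropy_masked_ge => // i; exact: y01.
Qed.

Lemma fin_entropy_prod_masked_le :
  fin_entropy (prod_mass mu nu) (prefix_of masked n) <=
  fin_entropy nu id + p * \sum_(i < n) fin_entropy mu (x i).
Proof.
have mn_ge0 := prod_mass_ge0 mu_ge0 nu_ge0.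
rewrite -(sum_mean (fun i => fin_entropy mu (x i))).
apply: (@le_trans _ _ (fin_entropy (prod_mass mu nu)
    (fun w => (w.2, prefix_of masked n w)))).
  by apply: fin_entropy_mono => // v w; rewrite xpair_eqE => /andP[].
rewrite fin_entropy_masked_and_mask lerD2l.
apply: ler_sum => w _; rewrite ler_wpM2l //.
by apply: fin_entropy_masked_le => // i; exact: y01.
Qed.

End masking.

(** * Existence of the entropy rate *)

(** Concavity and a 0 = 0 make the slopes a n / n nonincreasing.  The quotient
of index 0 is the junk value 0 / 0, so monotonicity starts at index 1. *)
Lemma concave_mean_cvg (R : realType) (a : nat -> R) :
  a 0%N = 0 -> (forall n, 0 <= a n) ->
  (forall n, a n.+2 + a n <= a n.+1 + a n.+1) ->
  cvgn (fun n => a n / n%:R : R).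
Proof.
move=> a0 a_ge0 conc; apply/cvg_ex.
have le_increment n : n%:R * (a n.+1 - a n) <= a n.
  elim: n => [|n IH]; first by rewrite mul0r a0.
  have := conc n; have : 0 <= n.+1%:R :> R by [].
  move: IH; rewrite -natr1; nra.
have := @nonincreasing_is_cvgn R (fun n => a n.+1 / n.+1%:R).
case/(_ _ _)/cvg_ex.
- apply/nonincreasing_seqP => n.
  rewrite ler_pdivrMr ?ltr0n // mulrAC ler_pdivlMr ?ltr0n //.
  have := le_increment n.+1; rewrite -[n.+2%:R]natr1; nra.
- by exists 0 => _ [n _ <-]; rewrite divr_ge0.
- by move=> l al; exists l; rewrite -cvg_shiftS.
Qed.

(** * From events to a finite space *)

Section law.
Context d (T : measurableType d) (R : realType) (P : probability T R).

Definition law (O : finType) (W : T -> O) (o : O) : R :=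
  fine (P [set w | W w = o]).

Definition measurable_fibers (O : finType) (W : T -> O) : Prop :=
  forall o, measurable [set w | W w = o].

Section one_variable.
Variables (O : finType) (W : T -> O).
Hypothesis sW : measurable_fibers W.

Lemma law_ge0 o : 0 <= law W o.
Proof. exact: fine_ge0. Qed.

Lemma law_pred (Q : pred O) :
  fine (P [set w | Q (W w)]) = \sum_(o | Q o) law W o.
Proof.
have -> : [set w | Q (W w)] = \bigcup_(o in [set` Q]) [set w | W w = o].
  by apply/seteqP; split => [w Qw|w [u Qu /= ->]]; [exists (W w)|].
rewrite measure_fin_bigcup //; last first.
  apply/trivIsetP => u u' _ _ /eqP ne; apply/seteqP.
  by split => // w [/= wu wu']; case: ne; rewrite -wu.
rewrite (@fsbigE _ _ _ _ _ (enum Q)) ?enum_uniq //; last first.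
- by move=> o Qo; rewrite mem_enum => /negP.
- by move=> o /=; rewrite mem_enum.
rewrite -sum_fine; last by move=> o _; rewrite fin_num_measure.
by rewrite big_enum_cond /=; apply: eq_bigl => o; rewrite mem_setE andbb.
Qed.

Lemma law_sum1 : \sum_o law W o = 1.
Proof.
rewrite -law_pred (_ : [set w | _] = setT); last exact/seteqP.
by rewrite probability_setT.
Qed.

(** The values of f o W that have positive probability are among the finitely
many values of f, and grouping the points of O by their image under f turns the
sum over values into the sum over points.  The factor ln 2 changes nats into
bits. *)
Lemma entropy_comp (E : choiceType) (f : O -> E) :
  entropy P (fun w => f (W w)) = fin_entropy (law W) f / ln 2.
Proof.
pose r := undup [seq f o | o <- enum O].
have f_r o : f o \in r by rewrite mem_undup map_f ?mem_enum.
have prE e : fine (P [set w | f (W w) = e]) = \sum_(o | f o == e) law W o.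
  rewrite -law_pred; congr (fine (P _)).
  by apply/seteqP; split => w /= /eqP.
rewrite /entropy (@fsbig_fwiden _ _ _ _ r) ?undup_uniq //; last first.
- move=> e [_ Ve] /=; rewrite (_ : [set w | _] = set0); last first.
    by apply/seteqP; split => // w /= fe; apply: Ve; exists w.
  by rewrite measure0 mul0r oppr0.
- by move=> _ [w _ <-] /=.
pose G o := - (law W o * (ln (class_mass (law W) f o) / ln 2)).
transitivity (\sum_(e <- r) \sum_(o | f o == e) G o).
  apply: eq_bigr => e _; rewrite /= prE sumrN mulr_suml; congr (- _).
  by apply: eq_bigr => o /eqP <-.
rewrite (exchange_big_dep xpredT) //= /fin_entropy mulNr mulr_suml -sumrN.
apply: eq_bigr => o _; rewrite -big_filter (eq_filter (a2 := pred1 (f o))).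
  by rewrite filter_pred1_uniq ?undup_uniq // big_seq1 /G mulrA.
by move=> e; rewrite eq_sym.
Qed.

End one_variable.

End law.

Section blocks.
Context d (T : measurableType d) (R : realType) (P : probability T R).

(** The value at w of a block and the sequence [prefix_of z k] at W w determine each
other, so they have the same entropy. *)
Lemma entropy_block (O : finType) (W : T -> O) (z : nat -> O -> R)
    (Z : int -> T -> R) k :
  measurable_fibers W ->
  (forall i w, (i < k)%N -> Z i%:Z w = z i (W w)) ->
  entropy P (block Z k) = fin_entropy (law P W) (prefix_of z k) / ln 2.
Proof.
move=> sW ZE.
have -> : block Z k = (fun w => [tuple z i (W w) | i < k]).
  by apply/funext => w; apply: eq_from_tnth => i; rewrite !tnth_mktuple ZE.
rewrite (entropy_comp P sW (fun u => [tuple z i u | i < k])); congr (_ / _).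
apply: eq_fin_entropy => v w; apply/eqP/eqP => [e|e].
  apply/eq_in_map => i; rewrite mem_iota add0n /= => ik.
  by have := congr1 (fun t => tnth t (Ordinal ik)) e; rewrite !tnth_mktuple.
apply: eq_from_tnth => i; rewrite !tnth_mktuple.
by have := congr1 (fun s => nth 0 s i) e; rewrite !nth_mkseq.
Qed.

Lemma entropy_block0 (Z : int -> T -> R) : entropy P (block Z 0) = 0.
Proof.
have s1 : measurable_fibers (fun _ : T => tt).
  move=> t; rewrite (_ : [set w | _] = setT) //; apply/seteqP.
  by split => // w _; case: t.
rewrite (@entropy_block _ _ (fun _ _ => 0) _ _ s1) //.
by rewrite (@fin_entropy_const _ _ _ _ _ [::]) ?mul0r //; exact: law_sum1.
Qed.

(** The windows of Z at times 0 .. n and 1 .. n + 1 are the same function of two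
finite variables with the same law.  Carrying such variables along, instead of
comparing the laws of Z itself, is what makes this property pass to functions of
several processes. *)
Definition finite_state_stationary (Z : int -> T -> R) : Prop :=
  forall n, exists (I : finType) (W W' : T -> I) (z : nat -> I -> R),
    [/\ measurable_fibers W, measurable_fibers W', law P W = law P W',
      forall i w, (i <= n)%N -> Z i%:Z w = z i (W w)
    & forall i w, (i <= n)%N -> Z (i%:Z + 1) w = z i (W' w)].

Lemma ln2_gt0 : 0 < ln 2 :> R.
Proof. by rewrite ln_gt0 // ltr1n. Qed.

(** Submodularity for the first and the last of n + 2 variables, given the n in
the middle; stationarity identifies the middle block and the last n + 1
variables with initial blocks. *)
Lemma entropy_rate_cvg (Z : int -> T -> R) : finite_state_stationary Z ->
  cvgn (fun n => entropy P (block Z n) / n%:R : R).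
Proof.
move=> statZ; apply: concave_mean_cvg => [|n|n].
- exact: entropy_block0.
- have [I [W [W' [z [sW sW' WW' ZE Z1E]]]]] := statZ n.
  rewrite (@entropy_block _ _ z _ _ sW) => [|i w /ltnW]; last exact: ZE.
  rewrite divr_ge0 ?(ltW ln2_gt0) // fin_entropy_ge0 //; first exact: law_ge0.
  exact: law_sum1.
have [I [W [W' [z [sW sW' WW' ZE Z1E]]]]] := statZ n.+1.
pose mu := law P W.
have blockE k : (k <= n.+2)%N ->
    entropy P (block Z k) = fin_entropy mu (prefix_of z k) / ln 2.
  move=> kn; apply: entropy_block => // i w ik.
  by rewrite ZE // -ltnS (leq_trans ik).
have blockSE k : (k <= n.+1)%N ->
    entropy P (block Z k) = fin_entropy mu (prefix_of (fun i => z i.+1) k) / ln 2.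
  move=> kn; transitivity (entropy P (block (fun i => Z (i + 1)) k)).
    rewrite blockE ?(leq_trans kn) // /mu WW'; apply/esym.
    by apply: entropy_block => // i w ik; rewrite Z1E // (leq_trans (ltnW ik)).
  apply: entropy_block => // i w ik.
  by rewrite -PoszD addn1 ZE // (leq_trans ik).
rewrite {1}blockE // [X in _ + X]blockSE ?leqnSn //.
rewrite [X in _ <= X + _]blockE ?leqnSn // [X in _ <= _ + X]blockSE //.
rewrite -!mulrDl ler_wpM2r ?invr_ge0 ?(ltW ln2_gt0) //.
have mu_ge0 : forall o, 0 <= mu o by exact: law_ge0.
have := fin_entropy_submodular mu_ge0 (z 0%N) (z n.+1)
  (prefix_of (fun i => z i.+1) n).
congr (_ + _ <= _ + _); apply: eq_fin_entropy => v w.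
- by rewrite prefix_ofSl prefix_ofS !xpair_eqE andbAC andbA.
- by rewrite prefix_ofSl xpair_eqE.
- by rewrite prefix_ofS xpair_eqE andbC.
Qed.

End blocks.

(** * Stationary processes with finitely many values *)

Lemma finite_state_coding (T : Type) (R : realType) (A : set R)
    (X : int -> T -> R) :
  finite_set A -> (forall i w, A (X i w)) ->
  exists (K : finType) (v : K -> R) (U : int -> T -> K),
    injective v /\ forall i w, X i w = v (U i w).
Proof.
move=> fA AX.
have XA i w : X i w \in fset_set A by rewrite in_fset_set // mem_set.
exists (fset_set A), val, (fun i w => [` XA i w]%fset).
by split => //; exact: val_inj.
Qed.

Section coded_process.
Context d (T : measurableType d) (R : realType) (P : probability T R).
Variables (K : finType) (v : K -> R) (v_inj : injective v).
Variables (X : int -> {RV P >-> R}) (U : int -> T -> K).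
Hypothesis XU : forall i w, X i w = v (U i w).

Definition cylinder (s : int) n (x : {ffun 'I_n -> K}) : set (int -> R) :=
  [set z | forall i : 'I_n, z ((i : nat)%:Z + s) = v (x i)].

Lemma cylinder_measurable s n (x : {ffun 'I_n -> K}) :
  path_measurable (cylinder s x).
Proof.
rewrite /path_measurable; set G := (X in <<s X >>).
have -> : cylinder s x = \bigcap_(i in [set: 'I_n])
    [set z : int -> R | z ((i : nat)%:Z + s) = v (x i)].
  by apply/seteqP; split => z zx i; [move=> _|]; exact: zx.
apply: (@fin_bigcap_measurable _ (g_sigma_algebraType G)).
  exact: finite_finset.
move=> i _; apply: sub_sigma_algebra.
by exists ((i : nat)%:Z + s), [set v (x i)]; split.
Qed.

Definition coded_block (s : int) n (w : T) : {ffun 'I_n -> K} :=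
  [ffun i : 'I_n => U ((i : nat)%:Z + s) w].

Lemma coded_blockE s n x :
  [set w | coded_block s n w = x] = [set w | cylinder s x (fun i => X i w)].
Proof.
apply/seteqP; split => w /=.
  by move=> <- i; rewrite ffunE XU.
by move=> xw; apply/ffunP => i; rewrite ffunE; apply: v_inj; rewrite -XU xw.
Qed.

Lemma measurable_fibers_coded i : measurable_fibers (U i).
Proof.
move=> k; have -> : [set w | U i w = k] = X i @^-1` [set v k].
  apply/seteqP; split => w /=; first by rewrite XU => ->.
  by rewrite XU => /v_inj.
by rewrite -[X in measurable X]setTI; exact: measurable_funP.
Qed.

Lemma measurable_fibers_coded_block s n : measurable_fibers (coded_block s n).
Proof.
move=> x; have -> : [set w | coded_block s n w = x] =
    \bigcap_(i in [set: 'I_n]) [set w | U ((i : nat)%:Z + s) w = x i].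
  apply/seteqP; split => w /=; first by move=> <- i _ /=; rewrite ffunE.
  by move=> xw; apply/ffunP => i; rewrite ffunE; exact: xw.
apply: fin_bigcap_measurable; first exact: finite_finset.
by move=> i _; exact: measurable_fibers_coded.
Qed.

Hypothesis statX : stationary X.

Lemma law_coded_block s n : law P (coded_block s n) = law P (coded_block 0 n).
Proof.
apply/funext => x; rewrite /law !coded_blockE.
rewrite -(statX s (cylinder_measurable 0 x)); congr (fine (P _)).
by apply/seteqP; split => w xw i /=; have := xw i; rewrite /= addr0.
Qed.

Lemma law_coded i : law P (U i) = law P (U 0).
Proof.
have UX j k : [set w | U j w = k] = [set w | [set z : int -> R | z 0 = v k]
    (fun l => X (l + j) w)].
  apply/seteqP; split => w /=; rewrite add0r XU; first by move=> ->.
  exact: v_inj.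
apply/funext => k; rewrite /law !UX (statX i) ?(statX 0) //.
  by apply: sub_sigma_algebra; exists 0, [set v k]; split.
by apply: sub_sigma_algebra; exists 0, [set v k]; split.
Qed.

End coded_process.

(** * Pairs of independent stationary processes *)

Section joint.
Context d (T : measurableType d) (R : realType) (P : probability T R).
Variables (K L : finType) (v : K -> R) (u : L -> R).
Hypotheses (v_inj : injective v) (u_inj : injective u).
Variables (X Y : int -> {RV P >-> R}) (U : int -> T -> K) (V : int -> T -> L).
Hypotheses (XU : forall i w, X i w = v (U i w)).
Hypotheses (YV : forall i w, Y i w = u (V i w)).
Hypotheses (statX : stationary X) (statY : stationary Y).
Hypothesis indep : independent_processes X Y.

Definition joint_block s n (w : T) := (coded_block U s n w, coded_block V s n w).

Lemma joint_blockE s n x y : [set w | joint_block s n w = (x, y)] =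
  [set w | cylinder v s x (fun i => X i w)] `&`
  [set w | cylinder u s y (fun i => Y i w)].
Proof.
rewrite -(coded_blockE v_inj XU) -(coded_blockE u_inj YV).
by apply/seteqP; split => [w /= [<- <-]|w [/= <- <-]].
Qed.

Lemma measurable_fibers_joint_block s n : measurable_fibers (joint_block s n).
Proof.
case=> x y.
have -> : [set w | joint_block s n w = (x, y)] =
    [set w | coded_block U s n w = x] `&` [set w | coded_block V s n w = y].
  by apply/seteqP; split => [w /= [<- <-]|w [/= <- <-]].
by apply: measurableI; [exact: (measurable_fibers_coded_block v_inj XU)
  | exact: (measurable_fibers_coded_block u_inj YV)].
Qed.

(** Independence factors the law, and stationarity of each factor removes the
shift. *)
Lemma law_joint_block s n : law P (joint_block s n) =
  prod_mass (law P (coded_block U 0 n)) (law P (coded_block V 0 n)).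
Proof.
rewrite -(law_coded_block v_inj XU statX s) -(law_coded_block u_inj YV statY s).
apply/funext => -[x y]; rewrite /law /prod_mass /= joint_blockE.
rewrite indep; try exact: cylinder_measurable.
rewrite -(coded_blockE v_inj XU) -(coded_blockE u_inj YV).
rewrite fineM ?fin_num_measure //.
  exact: (measurable_fibers_coded_block v_inj XU).
exact: (measurable_fibers_coded_block u_inj YV).
Qed.

Lemma finite_state_stationary_joint (phi : R -> R -> R) :
  finite_state_stationary P (fun i w => phi (X i w) (Y i w)).
Proof.
move=> n; exists ({ffun 'I_n.+1 -> K} * {ffun 'I_n.+1 -> L})%type.
exists (joint_block 0 n.+1), (joint_block 1 n.+1).
exists (fun i (xy : {ffun 'I_n.+1 -> K} * {ffun 'I_n.+1 -> L}) =>
  phi (v (xy.1 (inord i))) (u (xy.2 (inord i)))).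
split; try exact: measurable_fibers_joint_block; first by rewrite !law_joint_block.
- by move=> i w ik; rewrite /= !ffunE inordK // addr0 XU YV.
- by move=> i w ik; rewrite /= !ffunE inordK // XU YV.
Qed.

End joint.

(** * The masked process *)

Section masked_process.
Context d (T : measurableType d) (R : realType) (P : probability T R).
Variables (K : finType) (v : K -> R) (v_inj : injective v).
Variables (X Y : int -> {RV P >-> R}) (U : int -> T -> K) (V : int -> T -> bool).
Hypotheses (XU : forall i w, X i w = v (U i w)).
Hypotheses (YV : forall i w, Y i w = (V i w)%:R).
Hypotheses (statX : stationary X) (statY : stationary Y).
Hypothesis indep : independent_processes X Y.

Let u (b : bool) : R := b%:R.

Let u_inj : injective u.
Proof. by case=> -[] // /eqP; rewrite /u ?oner_eq0 // eq_sym oner_eq0. Qed.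

Let p := fine (P [set w | Y 0 w = 1]).

Let x n i (a : {ffun 'I_n.+1 -> K}) : R := v (a (inord i)).

Let y n i (b : {ffun 'I_n.+1 -> bool}) : R := u (b (inord i)).

Let xE n i w : (i < n.+1)%N -> X i%:Z w = x i (coded_block U 0 n.+1 w).
Proof. by move=> ik; rewrite XU /x ffunE inordK // addr0. Qed.

Let yE n i w : (i < n.+1)%N -> Y i%:Z w = y i (coded_block V 0 n.+1 w).
Proof. by move=> ik; rewrite YV /y ffunE inordK // addr0. Qed.

Let sX n : measurable_fibers (coded_block U 0 n).
Proof. exact: (measurable_fibers_coded_block v_inj XU). Qed.

Let sY n : measurable_fibers (coded_block V 0 n).
Proof. exact: (measurable_fibers_coded_block u_inj YV). Qed.

Lemma visit_set : [set w | Y 0 w = 1] = [set w | V 0 w = true].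
Proof.
apply/seteqP; split => w /=; rewrite YV; last by move=> ->.
by move=> /(@u_inj _ true).
Qed.

Lemma visit_mean n i : (i < n.+1)%N ->
  \sum_b law P (coded_block V 0 n.+1) b * y i b = p.
Proof.
move=> ik; rewrite /p visit_set -[RHS]/(law P (V 0) true).
rewrite -(law_coded u_inj YV statY i).
have -> : law P (V i) true =
    fine (P [set w | coded_block V 0 n.+1 w (inord i)]).
  congr (fine (P _)); apply/seteqP.
  by split => w /=; rewrite ffunE inordK // addr0.
rewrite (law_pred P (@sY n.+1) (fun b => b (inord i))) [RHS]big_mkcond /=.
apply: eq_bigr => b _; rewrite /y /u.
by case: (b _); rewrite ?mulr1 ?mulr0.
Qed.

(** Stationarity allows X i to be replaced by X 0. *)
Lemma coordinate_entropy n i : (i < n.+1)%N ->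
  fin_entropy (law P (coded_block U 0 n.+1)) (x i) = entropy P (X 0) * ln 2.
Proof.
move=> ik.
have entX j : entropy P (X j) = fin_entropy (law P (U j)) v / ln 2.
  rewrite -(entropy_comp P (measurable_fibers_coded v_inj XU j)).
  by congr (entropy P _); apply/funext => w; exact: XU.
rewrite entX -(law_coded v_inj XU statX i) -entX.
have -> : X i = (fun w => x i (coded_block U 0 n.+1 w)) :> (T -> R).
  by apply/funext => w; exact: xE.
rewrite (entropy_comp P (@sX n.+1)).
by rewrite divfK // gt_eqF ?ln2_gt0.
Qed.

(** The bounds on the product space, read for blocks and converted to bits.  The
block of Y determines the coded block of Y, hence the two have the same entropy. *)
Lemma entropy_block_masked n :
  p * entropy P (block (fun i => X i) n) <=
    entropy P (block (fun i w => X i w * Y i w) n) <=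
  entropy P (block (fun i => Y i) n) + n%:R * (p * entropy P (X 0)).
Proof.
case: n => [|n]; first by rewrite !entropy_block0 mulr0 mul0r addr0 lexx.
rewrite (entropy_block P (@sX n.+1) (@xE n)) (entropy_block P (@sY n.+1) (@yE n)).
pose m i (w : {ffun 'I_n.+1 -> K} * {ffun 'I_n.+1 -> bool}) := x i w.1 * y i w.2.
have sXY : measurable_fibers (joint_block U V 0 n.+1).
  exact: (measurable_fibers_joint_block v_inj u_inj XU YV).
rewrite (@entropy_block _ _ _ P _ _ m _ n.+1 sXY); last first.
  by move=> i w ik; rewrite (xE _ ik) (yE _ ik).
rewrite (law_joint_block v_inj u_inj XU YV statX statY indep).
have xH i : (i < n.+1)%N -> _ := @coordinate_entropy n i.
have yp i : (i < n.+1)%N -> _ := @visit_mean n i.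
move: xH yp; set mu := law P _; set nu := law P _ => xH yp.
have mu0 a : 0 <= mu a by exact: law_ge0.
have nu0 a : 0 <= nu a by exact: law_ge0.
have mu1 : \sum_a mu a = 1 by exact: law_sum1.
have nu1 : \sum_a nu a = 1 by exact: law_sum1.
have y01 i (b : {ffun 'I_n.+1 -> bool}) : (i < n.+1)%N -> y i b = 0 \/ y i b = 1.
  by rewrite /y /u => _; case: (b _); [right|left].
have l2 : 0 < (ln 2)^-1 :> R by rewrite invr_gt0 ln2_gt0.
apply/andP; split.
  by rewrite mulrA ler_pM2r //; exact: fin_entropy_prod_masked_ge.
have -> : fin_entropy nu (prefix_of (@y n) n.+1) = fin_entropy nu id.
  apply: eq_fin_entropy => b c; apply/eqP/eqP => [e|->//].
  apply/ffunP => i; apply: u_inj.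
  have := congr1 (fun s => nth 0 s i) e.
  by rewrite !nth_mkseq // /y inord_val.
rewrite -[_ * (p * _)](mulfK (lt0r_neq0 (@ln2_gt0 R))) -mulrDl ler_pM2r //.
have := @fin_entropy_prod_masked_le _ _ _ mu nu mu0 nu0 mu1 (@x n) (@y n) _ _
  y01 yp.
move=> /le_trans; apply.
rewrite lerD2l; under eq_bigr => i _ do rewrite xH //.
by rewrite sumr_const card_ord -[X in p * X <= _]mulr_natl mulrCA !mulrA.
Qed.

Lemma entropy_rate_joint_cvg (phi : R -> R -> R) :
  cvgn (fun n => entropy P (block (fun i w => phi (X i w) (Y i w)) n) / n%:R : R).
Proof.
apply: entropy_rate_cvg.
exact: (finite_state_stationary_joint v_inj u_inj XU YV).
Qed.

Lemma visit_gt0 : (0 < P [set w | Y 0%R w = 1%R])%E -> 0 < p.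
Proof.
move=> Y1; rewrite fine_gt0 // Y1 /= ltey_eq fin_num_measure // visit_set.
exact: (measurable_fibers_coded u_inj YV).
Qed.

End masked_process.

Theorem corollary1p9 (d : measure_display) (T : measurableType d)
    (R : realType) (P : probability T R) (X Y : int -> {RV P >-> R})
    (goodXY : good X Y) (HY0 : entropy_rate P (fun i => Y i) = 0) :
  let M : int -> T -> R := fun i w => X i w * Y i w in
  [/\ fine (P [set w | Y 0 w = 1]) * entropy_rate P (fun i => X i)
        <= entropy_rate P M,
      entropy_rate P M <= fine (P [set w | Y 0 w = 1]) * entropy P (X 0)
    & (0 < entropy_rate P (fun i => X i) -> 0 < entropy_rate P M)].
Proof.
move=> M; set p := fine _.
case: goodXY => statX statY [A [finA AX]] Y01 Y1 indep _.
have [K [v [U [v_inj XU]]]] := finite_state_coding finA AX.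
pose V i w := Y i w == 1.
have YV i w : Y i w = (V i w)%:R.
  rewrite /V; case: (Y01 i w) => ->; rewrite ?eqxx //.
  by rewrite eq_sym oner_eq0.
have cvg_rate := entropy_rate_joint_cvg v_inj XU YV statX statY indep.
have cvgXn := cvg_rate (fun a _ => a).
have cvgYn := cvg_rate (fun _ b => b).
have cvgMn := cvg_rate *%R.
have p_gt0 : 0 < p := visit_gt0 YV Y1.
have bounds := entropy_block_masked v_inj XU YV statX statY indep.
have lower : p * entropy_rate P (fun i => X i) <= entropy_rate P M.
  have cvgpX : (fun n => p * (entropy P (block (fun i => X i) n) / n%:R)) @ \oo -->
      p * entropy_rate P (fun i => X i).
    by apply: cvgM => //; exact: cvg_cst.
  apply: (ler_cvg_to cvgpX cvgMn); near=> n.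
  by rewrite mulrA ler_wpM2r //; case/andP: (bounds n).
split => //.
  (* the upper bound at index n tends to the entropy rate of Y plus p H(X_0) *)
  rewrite -[leRHS]add0r -HY0.
  have cvgB : (fun n => entropy P (block (fun i => Y i) n) / n%:R +
      p * entropy P (X 0)) @ \oo -->
      entropy_rate P (fun i => Y i) + p * entropy P (X 0).
    by apply: cvgD => //; exact: cvg_cst.
  apply: (ler_cvg_to cvgMn cvgB); near=> n.
  have n_gt0 : 0 < n%:R :> R by rewrite ltr0n; near: n; exists 1%N.
  rewrite ler_pdivrMr // mulrDl divfK ?gt_eqF // mulrC.
  by case/andP: (bounds n).
by move=> hX; apply: lt_le_trans lower; rewrite mulr_gt0.
Unshelve. all: by end_near.
Qed.
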